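(* Let $(X,\|\cdot\|)$ be a complex Banach space, let $p\in\mathcal{P}([0,1])$ and let $f:\mathbb{R}\to X$ be $S^{p(x)}$-almost periodic. Then $f$ is $S^{p(x)}$-almost automorphic.
   Context: Variable exponent spaces. $\mathcal{P}([0,1])$ is the set of all Lebesgue measurable functions $p:[0,1]\to[1,\infty]$. For $p\in\mathcal{P}([0,1])$ and $t\ge 0$ put $\varphi_{p(x)}(t)=t^{p(x)}$ if $p(x)<\infty$; if $p(x)=\infty$, put $\varphi_{p(x)}(t)=0$ for $0\le t\le 1$ and $\varphi_{p(x)}(t)=\infty$ for $t>1$. For measurable $u:[0,1]\to X$ let $\rho(u)=\int_0^1\varphi_{p(x)}(\|u(x)\|)\,dx$. The space $L^{p(x)}([0,1]:X)$ consists of all measurable $u:[0,1]\to X$ with $\rho(\lambda u)<\infty$ for some $\lambda>0$ (functions equal a.e. identified), with the Luxemburg norm $\|u\|_{L^{p(x)}([0,1]:X)}=\inf\{\lambda>0:\rho(u/\lambda)\le 1\}$; it is a Banach space. Stepanov $p(x)$-boundedness. Let $I=\mathbb{R}$ or $I=[0,\infty)$. $L_S^{p(x)}(I:X)$ is the space of measurable $f:I\to X$ such that $f(\cdot+t)\in L^{p(x)}([0,1]:X)$ for all $t\in I$ and $\|f\|_{S^{p(x)}}:=\sup_{t\in I}\|f(\cdot+t)\|_{L^{p(x)}([0,1]:X)}<\infty$. For $f\in L_S^{p(x)}(I:X)$ let $\hat f:I\to L^{p(x)}([0,1]:X)$, $\hat f(t):=f(t+\cdot)$. A function $f\in L_S^{p(x)}(\mathbb{R}:X)$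 is $S^{p(x)}$-almost periodic (Stepanov $p(x)$-almost periodic) iff $\hat f:\mathbb{R}\to L^{p(x)}([0,1]:X)$ is almost periodic in the sense of Bohr (i.e. continuous and for every $\epsilon>0$ there is $l>0$ such that every interval of length $l$ contains $\tau$ with $\|\hat f(t+\tau)-\hat f(t)\|\le\epsilon$ for all $t$). A function $f\in L_S^{p(x)}(\mathbb{R}:X)$ is $S^{p(x)}$-almost automorphic (Stepanov $p(x)$-almost automorphic) iff for every real sequence $(a_n)$ there exist a subsequence $(a_{n_k})$ and a function $g\in L_S^{p(x)}(\mathbb{R}:X)$ such that, for each $t\in\mathbb{R}$, $\lim_{k\to\infty}\|f(a_{n_k}+\cdot+t)-g(\cdot+t)\|_{L^{p(x)}([0,1]:X)}=0$ and $\lim_{k\to\infty}\|g(\cdot-a_{n_k}+t)-f(\cdot+t)\|_{L^{p(x)}([0,1]:X)}=0$. *)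

(* Defs.v *)
From mathcomp Require Import all_boot all_order all_algebra complex.
From mathcomp Require Import all_classical all_reals all_analysis measurable_realfun.

Set Implicit Arguments.
Unset Strict Implicit.
Unset Printing Implicit Defensive.

Import Order.TTheory GRing.Theory Num.Theory.
Import numFieldNormedType.Exports.

Local Open Scope classical_set_scope.
Local Open Scope ring_scope.
Local Open Scope complex_scope.

(** The real line with the sigma-algebra of Lebesgue measurable sets, on which
    [completed_lebesgue_measure] lives; the bare type [R] carries Borel sets. *)
Notation lebesgueR R :=
  (caratheodory_type (R := R) (T := ocitv_type R) (wlength idfun)^*%mu).

Definition unit_itv (R : realType) : set (lebesgueR R) := `[(0 : R), 1].

Section strong_measurability.
Context {d : measure_display} {T : measurableType d} {R : realType}.
Variable X : completeNormedModType R[i].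

Definition simple_on (D : set T) (s : T -> X) : Prop :=
  finite_set (s @` D) /\ forall c : X, measurable (D `&` s @^-1` [set c]).

(** Measurability of functions with values in a (possibly non-separable) Banach
    space is in the sense of Bochner. *)
Definition strongly_measurable (mu : {measure set T -> \bar R}) (D : set T)
    (u : T -> X) : Prop :=
  exists s : nat -> T -> X,
    (forall n, simple_on D (s n)) /\
    {ae mu, forall x, D x -> s n x @[n --> \oo] --> u x}.

End strong_measurability.

(** Functions on [0,1] are represented by total functions on the line whose
    values outside [0,1] are ignored. *)
Section variable_exponent_spaces.
Variable R : realType.
Local Notation mu := (@completed_lebesgue_measure R).

Definition variable_exponent (p : R -> \bar R) : Prop :=
  measurable_fun (@unit_itv R) (p : lebesgueR R -> \bar R) /\
  (forall x, @unit_itv R x -> (1 <= p x)%E).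

(** The value at the exponent [-oo] is a dummy. *)
Definition phi (q : \bar R) (t : R) : \bar R :=
  match q with
  | r%:E => (t `^ r)%:E
  | +oo => if (t <= 1)%R then 0%E else +oo%E
  | -oo => 0%E
  end%E.

Variable X : completeNormedModType R[i].

(** The library norm of a complex normed space takes values in [R[i]]. *)
Definition rnorm (x : X) : R := complex.Re `|x|.

Definition modular (p : R -> \bar R) (u : R -> X) : \bar R :=
  (\int[mu]_(x in @unit_itv R) phi (p x) (rnorm (u x)))%E.

Definition in_Lp (p : R -> \bar R) (u : R -> X) : Prop :=
  strongly_measurable mu (@unit_itv R) (u : lebesgueR R -> X) /\
  exists2 l : R, 0 < l & (modular p (fun x => l%:C *: u x) < +oo)%E.

(** Almost everywhere equal functions are not identified: this is a seminorm on
    representatives, and it is [+oo] when no scaling has modular at most 1. *)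
Definition luxemburg_norm (p : R -> \bar R) (u : R -> X) : \bar R :=
  ereal_inf [set l%:E | l in
    [set l : R | 0 < l /\ (modular p (fun x => (l^-1)%:C *: u x) <= 1)%E]].

Definition stepanov_norm (p : R -> \bar R) (f : R -> X) : \bar R :=
  ereal_sup (range (fun t : R => luxemburg_norm p (fun x => f (x + t)))).

Definition stepanov_bounded (p : R -> \bar R) (f : R -> X) : Prop :=
  [/\ strongly_measurable mu setT (f : lebesgueR R -> X),
      forall t : R, in_Lp p (fun x => f (x + t)) &
      (stepanov_norm p f < +oo)%E].

(** Bohr almost periodicity of [F : R -> Y] when [Y] is equipped with an
    extended-real-valued (pseudo)distance [dist]. *)
Definition bohr_almost_periodic (Y : Type) (dist : Y -> Y -> \bar R)
    (F : R -> Y) : Prop :=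
  (forall t : R, dist (F s) (F t) @[s --> t] --> 0%E) /\
  (forall e : R, 0 < e -> exists2 l : R, 0 < l &
    forall a : R, exists2 tau : R, a <= tau <= a + l &
      forall t : R, (dist (F (t + tau)%R) (F t) <= e%:E)%E).

Definition luxemburg_dist (p : R -> \bar R) (u v : R -> X) : \bar R :=
  luxemburg_norm p (fun x => u x - v x).

Definition bochner_transform (f : R -> X) : R -> (R -> X) :=
  fun t x => f (t + x).

Definition stepanov_almost_periodic (p : R -> \bar R) (f : R -> X) : Prop :=
  stepanov_bounded p f /\
  bohr_almost_periodic (luxemburg_dist p) (bochner_transform f).

Definition stepanov_almost_automorphic (p : R -> \bar R) (f : R -> X) : Prop :=
  stepanov_bounded p f /\
  forall a : nat -> R, exists (n : nat -> nat) (g : R -> X),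
    [/\ {homo n : i j / (i < j)%N},
        stepanov_bounded p g &
        forall t : R,
          luxemburg_dist p (fun x => f (a (n k) + x + t)) (fun x => g (x + t))
            @[k --> \oo] --> 0%E /\
          luxemburg_dist p (fun x => g (x - a (n k) + t)) (fun x => f (x + t))
            @[k --> \oo] --> 0%E].

End variable_exponent_spaces.

(* Main.v *)
Require Import Defs.
From mathcomp Require Import all_boot all_order all_algebra complex.
From mathcomp Require Import all_classical all_reals all_analysis.
From mathcomp Require Import measurable_realfun ring lra.

(** A Bohr almost periodic map into a complete metric space has relatively
    compact range of translates (Bochner), so every sequence of translates has a
    uniformly convergent subsequence; a uniform limit can be translated back, and
    that is almost automorphy. Here the space is $L^{p(x)}$, the map is the
    Bochner transform of [f], and the limit has to be produced as the Bochner
    transform of a single measurable function [g] on the line.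

    Bochner's criterion ([almost_periodic_bochner]) only uses that the Luxemburg
    distance is a pseudometric. Given [a], relative density provides almost
    periods [tau n] moving [a n] into a fixed interval [[0, l]]; along an
    ultrafilter the points [a n + tau n] converge, and uniform continuity makes
    the translates by [a n] mutually close. One ultrafilter serves all precisions
    at once, so a subsequence is extracted whose [k]-th term is within [e k] of
    all later ones, with [e] summable, uniformly over the line.

    For such a fast subsequence the functions [x |-> f (a (n k) + x)] converge
    almost everywhere: since $t\le 1+t^q$ for $q\ge 1$, the Luxemburg norm
    dominates the $L^1$ norm on [[0, 1]] whatever the exponent is, so the
    increments are summable in $L^1$ on every unit interval
    ([luxemburg_summable_ae_cvg]). The pointwise limit [g] is strongly measurable
    ([strongly_measurable_ae_lim]), and Fatou's lemma
    ([luxemburg_lower_semicontinuous]) turns the mutual closeness into closeness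
    to [g], uniformly over all translates. Uniformity gives the second limit of
    almost automorphy for free: it is the first one, evaluated at
    [t - a (n k)]. *)

Set Implicit Arguments.
Unset Strict Implicit.
Unset Printing Implicit Defensive.

Import Order.TTheory GRing.Theory Num.Theory.
Import numFieldNormedType.Exports.

Local Open Scope classical_set_scope.
Local Open Scope ring_scope.
Local Open Scope complex_scope.

(** * Translation invariance of Lebesgue measure *)

Section lebesgue_translation.
Variable R : realType.
Local Notation mu := (@completed_lebesgue_measure R).
Local Notation tr t := (fun x : R => x + t).

Lemma preimage_translate_oc (t a b : R) :
  tr t @^-1` `]a, b] = `](a - t), (b - t)]%classic.
Proof.
by apply/seteqP; split => x /=; rewrite !in_itv/= ltrBlDr lerBrDr.
Qed.

Lemma ocitv_translate (t : R) (A : set (ocitv_type R)) : measurable A ->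
  measurable (tr t @^-1` A : set (ocitv_type R)) /\
  wlength idfun (tr t @^-1` A : set (ocitv_type R)) = wlength idfun A.
Proof.
move=> [[a b] _ <-] /=; rewrite preimage_translate_oc; split; first exact: is_ocitv.
rewrite !wlength_itv/= !lte_fin ltrD2r; case: ifP => // _.
by rewrite -!EFinB; congr (_%:E); ring.
Qed.

(** A cover of [A] by half-open intervals translates to a cover of the translate
    with the same lengths; the reverse inequality is this one for [- t]. *)
Lemma outer_lebesgue_translate_le (t : R) (A : set (ocitv_type R)) :
  ((wlength idfun)^*%mu (tr t @^-1` A) <= (wlength idfun)^*%mu A)%E.
Proof.
apply: le_ereal_inf_tmp => _ [F [mF AF] <-].
apply: ereal_inf_lbound; exists (fun k => tr t @^-1` F k).
  split => [k|x /AF [k _ Fk]]; [exact: (ocitv_translate t (mF k)).1|by exists k].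
by apply: eq_eseriesr => k _; exact: (ocitv_translate t (mF k)).2.
Qed.

Lemma preimage_translateK (t : R) (A : set R) : tr t @^-1` (tr (- t) @^-1` A) = A.
Proof. by apply/seteqP; split => x /=; rewrite addrK. Qed.

Lemma outer_lebesgue_translate (t : R) (A : set (ocitv_type R)) :
  (wlength idfun)^*%mu (tr t @^-1` A) = (wlength idfun)^*%mu A.
Proof.
apply/eqP; rewrite eq_le outer_lebesgue_translate_le/=.
rewrite -{1}(preimage_translateK (- t) A) opprK.
exact: outer_lebesgue_translate_le.
Qed.

(** Caratheodory's criterion only speaks of the outer measure, so its translation
    invariance carries over to all Lebesgue measurable sets, not only Borel ones. *)
Lemma measurable_translate (t : R) (A : set (lebesgueR R)) :
  measurable A -> measurable (tr t @^-1` A : set (lebesgueR R)).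
Proof.
move=> mA; have {}mA : caratheodory_measurable (wlength idfun)^*%mu A := mA.
suff : caratheodory_measurable (wlength idfun)^*%mu (tr t @^-1` A) by [].
move=> X; rewrite -(outer_lebesgue_translate (- t) X) mA.
rewrite -(outer_lebesgue_translate t (_ `&` A)).
rewrite -(outer_lebesgue_translate t (_ `&` ~` A)).
by rewrite !preimage_setI preimage_translateK.
Qed.

Lemma ae_translate (t : R) (P : R -> Prop) :
  {ae mu, forall x, P x} -> {ae mu, forall x, P (x + t)}.
Proof.
move=> [N [mN N0 PN]]; exists (tr t @^-1` N); split.
- exact: measurable_translate.
- by rewrite -N0; exact: outer_lebesgue_translate.
- by move=> x /= nP; apply: PN.
Qed.

End lebesgue_translation.

(** * The real-valued norm *)

Section rnorm_theory.
Variables (R : realType) (X : completeNormedModType R[i]).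
Implicit Types (x y : X).

(** Passage between the two norms: the complex-valued one of the normed space
    and its real part, on which all estimates are done. *)
Lemma complex_normE x : `|x| = (rnorm x)%:C.
Proof. by rewrite /rnorm RRe_real// ger0_real. Qed.

Lemma rnorm_ge0 x : 0 <= rnorm x.
Proof. by rewrite -lecR -complex_normE; exact: normr_ge0. Qed.

Lemma rnorm0 : rnorm (0 : X) = 0.
Proof. by apply: (@complexI R); rewrite -complex_normE normr0. Qed.

Lemma ler_rnormD x y : rnorm (x + y) <= rnorm x + rnorm y.
Proof. rewrite -lecR rmorphD/= -!complex_normE; exact: ler_normD. Qed.

Lemma rnormN x : rnorm (- x) = rnorm x.
Proof. by rewrite /rnorm; congr (complex.Re _); exact: normrN. Qed.

Lemma rdistC x y : rnorm (x - y) = rnorm (y - x).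
Proof. by rewrite -rnormN opprB. Qed.

Lemma ler_rdistD y x z : rnorm (x - z) <= rnorm (x - y) + rnorm (y - z).
Proof. by rewrite -{1}(subrK y x) -addrA; exact: ler_rnormD. Qed.

Lemma rnormZ (l : R) x : 0 <= l -> rnorm (l%:C *: x) = l * rnorm x.
Proof.
move=> l0; apply: (@complexI R); rewrite -complex_normE normrZ complex_normE rmorphM/=.
by rewrite ger0_norm// lecR.
Qed.

Lemma gt0_realC (e : R[i]) : 0 < e -> e = (complex.Re e)%:C /\ 0 < complex.Re e.
Proof.
move=> e0; have eE : e = (complex.Re e)%:C by rewrite RRe_real// gtr0_real.
by split=> //; rewrite -ltcR -eE.
Qed.

Lemma cvg_rdistP (s : nat -> X) (l : X) :
  s n @[n --> \oo] --> l <->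
  forall e : R, 0 < e -> \forall n \near \oo, rnorm (s n - l) < e.
Proof.
split=> [/cvgrPdist_lt sl e e0|sl].
  have /sl : 0 < e%:C by rewrite ltcR.
  by apply: filterS => n; rewrite complex_normE ltcR rdistC.
apply/cvgrPdist_lt => e /gt0_realC[-> /sl]; apply: filterS => n.
by rewrite complex_normE ltcR rdistC.
Qed.

Lemma rdist_cauchy_cvg (s : nat -> X) :
  (forall e : R, 0 < e -> exists N, forall n, (N <= n)%N ->
    rnorm (s n - s N) < e) -> exists l : X, s n @[n --> \oo] --> l.
Proof.
move=> cs; suff /cvg_ex[l sl] : [cvg s n @[n --> \oo] in X] by exists l.
apply/cauchy_cvgP/cauchy_exP => e /gt0_realC[-> /cs[N sN]]; exists (s N).
by exists N => // n /= /sN; rewrite -ball_normE /= complex_normE ltcR rdistC.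
Qed.

End rnorm_theory.

(** * Strongly measurable functions *)

Section simple_functions.
Context {d : measure_display} {T : measurableType d} {R : realType}.
Variables (X : completeNormedModType R[i]) (D : set T).
Implicit Types (s : T -> X).

(** Only finitely many pairs of values occur, so the set is a finite union of
    intersections of level sets. All measurability facts about simple functions
    below are instances. *)
Lemma simple_on_rel2 s1 s2 (P : X -> X -> Prop) :
  simple_on D s1 -> simple_on D s2 ->
  measurable (D `&` [set x | P (s1 x) (s2 x)]).
Proof.
move=> [fs1 ms1] [fs2 ms2].
rewrite (_ : _ `&` _ = \bigcup_(c in [set c | ((s1 @` D) `*` (s2 @` D)) c /\
    P c.1 c.2]) ((D `&` s1 @^-1` [set c.1]) `&` (D `&` s2 @^-1` [set c.2]))).
  apply: fin_bigcup_measurable => [|c _]; last exact: measurableI.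
  apply: sub_finite_set (finite_setX fs1 fs2) => c [] //.
apply/seteqP; split => [x [Dx Px]|x [c [_ Pc] [[Dx /= e1] [_ /= e2]]]].
  exists (s1 x, s2 x) => //; split=> //.
  by split; exists x.
by split=> //=; rewrite e1 e2.
Qed.

Lemma simple_on_comp2 s1 s2 (h : X -> X -> X) :
  simple_on D s1 -> simple_on D s2 -> simple_on D (fun x => h (s1 x) (s2 x)).
Proof.
move=> ss1 ss2; split=> [|c]; last exact: (simple_on_rel2 (fun a b => h a b = c)).
apply: sub_finite_set (finite_image (fun c => h c.1 c.2)
  (finite_setX ss1.1 ss2.1)) => _ [x Dx <-].
by exists (s1 x, s2 x) => //; split; exists x.
Qed.

End simple_functions.

Section strong_measurability_theory.
Context {d : measure_display} {T : measurableType d} {R : realType}.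
Variables (X : completeNormedModType R[i]) (mu : {measure set T -> \bar R}).
Implicit Types (D : set T) (u v : T -> X).

Lemma strongly_measurable_sub D u v :
  strongly_measurable mu D u -> strongly_measurable mu D v ->
  strongly_measurable mu D (fun x => u x - v x).
Proof.
move=> [s [ss su]] [r [sr rv]]; exists (fun n x => s n x - r n x); split.
  by move=> n; exact: (simple_on_comp2 (fun a b => a - b)).
by apply: filterS2 su rv => x su rv Dx; apply: cvgB; [exact: su|exact: rv].
Qed.

Lemma strongly_measurableS D u : measurable D ->
  strongly_measurable mu setT u -> strongly_measurable mu D u.
Proof.
move=> mD [s [ss su]]; exists s; split=> [n|]; last first.
  by apply: filterS su => x su _; exact: su.
split=> [|c].
  by apply: sub_finite_set (ss n).1; exact: image_subset.
by apply: measurableI => //; rewrite -[X in measurable X]setTI; exact: (ss n).2.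
Qed.

(** The norm of [u] is almost everywhere the limit of the norms of simple
    functions; completeness of the measure makes the exceptional set harmless. *)
Lemma measurable_rnorm D u : measure_is_complete mu ->
  strongly_measurable mu D u -> measurable_fun D (fun x => rnorm (u x)).
Proof.
move=> cmu [s [ss su]]; apply/measurable_EFinP.
apply: (@ae_measurable_fun _ _ _ mu cmu D
    (fun x => limn_esup (fun n => (rnorm (s n x))%:E))).
  apply: filterS su => x + Dx => /(_ Dx) su.
  apply: (cvg_limn_einf_sup _).2; apply/cvg_EFin; first by near=> n.
  apply/cvgrPdist_lt => e e0; have /cvg_rdistP/(_ e e0) := su.
  apply: filterS => n /=; apply: le_lt_trans.
  have := ler_rnormD (u x - s n x) (s n x); rewrite subrK rdistC => h1.
  have := ler_rnormD (s n x - u x) (u x); rewrite subrK => h2.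
  by rewrite ler_norml; apply/andP; split; lra.
apply: measurable_fun_limn_esup => n; apply/measurable_EFinP => _ B mB.
exact: (simple_on_rel2 (fun a _ => B (rnorm a)) (ss n) (ss n)).
Unshelve. all: by end_near. Qed.

End strong_measurability_theory.

Section limit.
Context {d : measure_display} {T : measurableType d} {R : realType}.
Variables (X : completeNormedModType R[i]).
Variable (mu : {measure set T -> \bar R}).

(** Egorov's theorem at a single precision [e]. It is phrased through the mutual
    oscillation of the approximants, whose measurability is clear. *)
Lemma small_oscillation (E : set T) (s : nat -> T -> X) (u : T -> X) (e r : R) :
  measurable E -> (mu E < +oo)%E -> (forall n, simple_on setT (s n)) ->
  {ae mu, forall x, s n x @[n --> \oo] --> u x} -> 0 < e -> 0 < r ->
  exists NB : nat * set T, [/\ measurable NB.2, (mu NB.2 <= r%:E)%E &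
    forall x, E x -> ~ NB.2 x -> forall n, (NB.1 <= n)%N ->
      rnorm (s n x - s NB.1 x) <= e].
Proof.
move=> mE Eoo ss su e0 r0.
pose osc m n := [set x | e < rnorm (s m x - s n x)].
have mosc m n : measurable (osc m n).
  rewrite -[osc m n]setTI.
  exact: (simple_on_rel2 (fun a b => e < rnorm (a - b)) (ss m) (ss n)).
(* [B N] decreases to a subset of the null set where [s n x] diverges. *)
pose B N := E `&`
  \bigcup_(m in [set m | (N <= m)%N]) \bigcup_(n in [set n | (N <= n)%N]) osc m n.
have mB N : measurable (B N).
  by apply: measurableI => //; do 2 (apply: bigcup_measurable => ? _).
have mB_ : measurable (\bigcap_N B N) by exact: bigcap_measurable.
have B0 : mu (\bigcap_N B N) = 0.
  apply/(negligibleP mu mB_); apply: negligibleS su => x Bx /= /cvg_rdistP.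
  have e20 : 0 < e / 2 by rewrite divr_gt0.
  move=> /(_ _ e20)[N _ sN]; have [_ [m /= Nm [n /= Nn]]] := Bx N I.
  have /= := sN _ Nm; have /= := sN _ Nn; rewrite /osc/=.
  by rewrite (rdistC (s n x)); have := ler_rdistD (u x) (s m x) (s n x); lra.
have : (mu \o B) N @[N --> \oo] --> 0%E.
  rewrite -B0; apply: nonincreasing_cvg_mu => //.
    by apply: le_lt_trans Eoo; apply: le_measure; rewrite ?inE//; exact: subIsetl.
  move=> N M NM; apply/subsetPset => x [Ex [m /= Nm [n /= Nn h]]]; split=> //.
  by exists m => /=; [exact: leq_trans Nm|exists n => //=; exact: leq_trans Nn].
move=> /fine_cvgP[Bfin] /cvgrPdist_lt/(_ r r0) Br.
have [N _ /(_ N (leqnn _)) [/= NF]] := filterI Bfin Br.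
rewrite sub0r normrN => NB.
exists (N, B N); split => //=.
  rewrite -(fineK NF) lee_fin; apply: ltW; exact: le_lt_trans (ler_norm _) NB.
move=> x Ex nB n Nn; rewrite leNgt; apply/negP => h; apply: nB; split=> //.
by exists n => //; exists N => //=.
Qed.

(** Diagonal argument: for each [k] choose a simple function that is [1/(k+1)]
    close to [u_ k] on the [k]-th set of an exhaustion by sets of finite measure,
    outside a set of measure at most $2^{-(k+1)}$. By the Borel-Cantelli lemma
    almost every point is in finitely many of the exceptional sets, so the chosen
    functions converge almost everywhere to the limit of the [u_ k]. *)
Lemma strongly_measurable_ae_lim (u_ : nat -> T -> X) (u : T -> X) :
  sigma_finite setT mu ->
  (forall k, strongly_measurable mu setT (u_ k)) ->
  {ae mu, forall x, u_ k x @[k --> \oo] --> u x} ->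
  strongly_measurable mu setT u.
Proof.
move=> /sigma_finiteP[F [FT ndF mF]] /choice[s hs] uu.
have pow0 k : 0 < 1 / (2 ^ (k + 1))%:R :> R by rewrite divr_gt0// ltr0n expn_gt0.
have /choice[NB hNB] : forall k, exists NB : nat * set T,
    [/\ measurable NB.2, (mu NB.2 <= (1 / (2 ^ (k + 1))%:R)%:E)%E &
      forall x, F k x -> ~ NB.2 x -> forall n, (NB.1 <= n)%N ->
        rnorm (s k n x - s k NB.1 x) <= k.+1%:R^-1].
  move=> k; apply: (@small_oscillation (F k) (s k) (u_ k)) => //.
  - exact: (mF k).1.
  - exact: (mF k).2.
  - exact: (hs k).1.
  - by apply: filterS (hs k).2 => x; exact.
pose B k := (NB k).2; pose N k := (NB k).1.
have B0 : mu (lim_sup_set B) = 0.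
  apply: lim_sup_set_cvg0 => [k|]; first by have [] := hNB k.
  apply: (@le_lt_trans _ _ (\sum_(0 <= k <oo) (1 / (2 ^ (k + 1))%:R)%:E)%E).
    by apply: lee_nneseries => // k _; have [] := hNB k.
  by have /cvg_lim -> // := @cvg_geometric_eseries_half R 1 0; rewrite ltry.
have aeB : {ae mu, forall x, ~ lim_sup_set B x}.
  exists (lim_sup_set B); split => //; last by move=> x /= /contrapT.
  by apply: bigcap_measurable => // k _; apply: bigcup_measurable => j _;
    have [] := hNB j.
exists (fun k => s k (N k)); split=> [k|]; first exact: (hs k).1.
have aes : {ae mu, forall x, forall k, s k n x @[n --> \oo] --> u_ k x}.
  by apply: ae_foralln => k; apply: filterS (hs k).2 => x; exact.
apply: filterS3 aeB aes uu => x nB sx ux _; apply/cvg_rdistP => e e0.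
have e30 : 0 < e / 3 by rewrite divr_gt0.
have [K0 Kx] : exists K, F K x.
  by have : setT x by []; rewrite FT => -[K _ ?]; exists K.
have [K1 nBK] : exists K, forall k, (K <= k)%N -> ~ B k x.
  apply: contra_notP nB => nB K _; apply: contra_notP nB => nB.
  by exists K => k Kk Bk; apply: nB; exists k.
have /cvg_rdistP/(_ _ e30) ue := ux.
near=> k.
have Fkx : F k x.
  have /subsetPset : (F K0 <= F k)%O by apply: ndF; near: k; exact: nbhs_infty_ge.
  exact.
have nBk : ~ B k x by apply: nBK; near: k; exact: nbhs_infty_ge.
have uk : rnorm (u_ k x - u x) < e / 3 by near: k.
have ke : k.+1%:R^-1 < e / 3 by near: k; exact: near_infty_natSinv_lt (PosNum e30).
have /cvg_rdistP/(_ _ e30)[M _ sM] := sx k.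
have [_ _ /(_ x Fkx nBk (maxn M (N k)) (leq_maxr _ _)) h1] := hNB k.
have /= h2 := sM (maxn M (N k)) (leq_maxl _ _).
have h3 := ler_rdistD (s k (maxn M (N k)) x) (s k (N k) x) (u x).
have h4 := ler_rdistD (u_ k x) (s k (maxn M (N k)) x) (u x).
rewrite rdistC in h1; have {}h1 := le_lt_trans h1 ke.
by rewrite /N in h1 h2 h3 h4 *; lra.
Unshelve. all: by end_near. Qed.

End limit.

Section translation.
Variables (R : realType) (X : completeNormedModType R[i]).
Local Notation mu := (@completed_lebesgue_measure R).

Lemma strongly_measurable_translate (t : R) (u : R -> X) :
  strongly_measurable mu setT (u : lebesgueR R -> X) ->
  strongly_measurable mu setT ((fun x : R => u (x + t)) : lebesgueR R -> X).
Proof.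
move=> [s [ss su]]; exists (fun n x => s n (x + t : R)); split=> [n|].
  split=> [|c].
    by apply: sub_finite_set (ss n).1 => _ [x _ <-]; exists (x + t : R).
  by have := measurable_translate t ((ss n).2 c); rewrite !setTI.
have [N [mN N0 sN]] := ae_translate t su; by exists N.
Qed.

End translation.

(** * Inferior limits *)

Section limn_einf_theory.
Variable R : realType.
Implicit Types (b : nat -> \bar R) (c : \bar R).

Lemma le_limn_einf b c : (\forall n \near \oo, (c <= b n)%E) ->
  (c <= limn_einf b)%E.
Proof.
move=> [N _ Nb]; rewrite limn_einf_lim; apply: lime_ge.
  exact: is_cvg_einfs.
exists N => // n /= Nn; apply: le_ereal_inf_tmp => _ [k /= nk <-].
by apply: Nb => /=; exact: leq_trans nk.
Qed.

Lemma limn_einf_le b c : (forall n, (b n <= c)%E) -> (limn_einf b <= c)%E.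
Proof.
move=> bc; rewrite limn_einf_lim; apply: lime_le; first exact: is_cvg_einfs.
apply: nearW => n; apply: le_trans (bc n).
by apply: ereal_inf_lbound; exists n => /=.
Qed.

Lemma measurable_fun_limn_einf d (T : measurableType d) (D : set T)
    (f : nat -> T -> \bar R) : (forall n, measurable_fun D (f n)) ->
  measurable_fun D (fun x => limn_einf (f^~ x)).
Proof.
move=> mf; rewrite /limn_einf; apply: measurableT_comp => //.
by apply: measurable_fun_limn_esup => n; exact: measurableT_comp.
Qed.

End limn_einf_theory.

(** * Powers with a variable exponent *)

Section phi_theory.
Variable R : realType.
Implicit Types (q : \bar R) (s t a b : R).

Lemma phi_ge0 q t : (0 <= phi q t)%E.
Proof. by case: q => [r| |] //=; [rewrite lee_fin powR_ge0|case: ifP]. Qed.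

Lemma phi_at0 q : (1 <= q)%E -> phi q 0 = 0%E.
Proof.
case: q => [r| |] //=; last by rewrite ler01.
by rewrite lee_fin => r1; rewrite powR0// gt_eqF// (lt_le_trans ltr01).
Qed.

Lemma phi_homo q s t : (1 <= q)%E -> 0 <= s -> s <= t -> (phi q s <= phi q t)%E.
Proof.
move=> + s0 st; case: q => [r| |] //=.
  rewrite !lee_fin => r1; apply: ge0_ler_powR; rewrite ?nnegrE//.
    exact: le_trans ler01 r1.
  exact: le_trans st.
by move=> _; case: (leP t 1) => [t1|]; [rewrite (le_trans st)|case: ifP; rewrite ?leey].
Qed.

(** Both weights are positive because for an infinite exponent the right-hand side
    would otherwise lose an infinite term multiplied by 0. *)
Lemma phi_convex q s t a b : (1 <= q)%E -> 0 <= s -> 0 <= t ->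
  0 < a -> 0 < b -> a + b = 1 ->
  (phi q (a * s + b * t) <= a%:E * phi q s + b%:E * phi q t)%E.
Proof.
move=> + s0 t0 a0 b0 ab; have -> : b = 1 - a by lra.
case: q => [r| |] //=.
  rewrite !lee_fin => r1; apply: (convex_powR r1 (Itv01 _ _)) => //=.
  - exact: ltW.
  - by lra.
  - by rewrite inE/= in_itv/= s0.
  - by rewrite inE/= in_itv/= t0.
move=> _; have b0' : 0 < 1 - a by lra.
case: (leP s 1) => s1; case: (leP t 1) => t1.
- by rewrite ifT ?mule0 ?adde0//; nra.
- by rewrite gt0_muley ?lte_fin// mule0 add0e leey.
- by rewrite gt0_muley ?lte_fin// mule0 adde0 leey.
- by rewrite !gt0_muley ?lte_fin// addye// leey.
Qed.

(** This is what embeds the variable exponent space of a set of finite measure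
    into $L^1$, uniformly in the exponent. *)
Lemma le_1Dphi q t : (1 <= q)%E -> 0 <= t -> (t%:E <= 1 + phi q t)%E.
Proof.
move=> q1 t0; case: (leP t 1) => [t1|t1].
  by rewrite -[leLHS]adde0 leeD// ?lee_fin// phi_ge0.
rewrite -[leLHS]add0e leeD// ?lee_fin//.
case: q q1 => [r| |] //=; last first.
  by rewrite ifF ?leey//; exact: lt_geF.
by rewrite !lee_fin => r1; rewrite -[leLHS]powRr1// ler_powR// ltW.
Qed.

(** The exponent varies with the point, so the power is written as an exponential
    of a product away from the zeros of [v] and the points of infinite exponent. *)
Lemma measurable_phi d (T : measurableType d) (D : set T) (p : T -> \bar R)
    (v : T -> R) : measurable D -> measurable_fun D p -> measurable_fun D v ->
  (forall x, D x -> (1 <= p x)%E) ->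
  measurable_fun D (fun x => phi (p x) (v x)).
Proof.
move=> mD mp mv p1.
apply: (eq_measurable_fun (fun x => if p x == +oo%E then
    (if v x <= 1 then 0%E else +oo%E) else
    (if v x == 0 then 0 else expR (fine (p x) * ln (v x)))%:E)) => [x|].
  rewrite inE => /p1; case: (p x) => [r| |] //=; rewrite ?eqxx// lee_fin => r1.
  rewrite /powR; case: ifPn => // _.
  by rewrite gt_eqF// (lt_le_trans ltr01).
have subI A : D `&` A `<=` D by exact: subIsetl.
have mDoo (b : bool) : measurable (D `&` (fun x => p x == +oo%E) @^-1` [set b]).
  exact: (measurable_fun_eqe mp (measurable_cst _)).
have mDI (b : bool) : measurable_fun (D `&` (fun x => p x == +oo%E) @^-1` [set b]) v.
  exact: measurable_funS mv.
apply: measurable_fun_if => //.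
- exact: measurable_fun_eqe.
- by apply: measurable_fun_if => //; exact: measurable_fun_ler.
- apply/measurable_EFinP; apply: measurable_fun_if => //.
    exact: measurable_fun_eqr.
  apply: (@measurable_funS _ _ _ _ D) => //.
    by move=> x [[]].
  apply: measurableT_comp => //; apply: measurable_funM.
    exact: measurableT_comp.
  exact: (measurableT_comp (@measurable_ln R)).
Qed.
End phi_theory.

(** * The Luxemburg norm *)

Section luxemburg.
Variables (R : realType) (X : completeNormedModType R[i]) (p : R -> \bar R).
Hypothesis hp : variable_exponent p.
Local Notation mu := (@completed_lebesgue_measure R).
Local Notation I01 := (@unit_itv R).
Implicit Types (u v w : R -> X) (l m : R).
Local Notation sm u := (strongly_measurable mu I01 (u : lebesgueR R -> X)).

Lemma measurable_unit_itv : measurable I01.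
Proof.
apply: (@sub_caratheodory _ _ _ (wlength idfun)).
exact: (measurable_itv `[(0 : R), 1]).
Qed.

Lemma measure_unit_itv :
  (mu : {measure set (lebesgueR R) -> \bar R}) I01 = 1%E.
Proof.
rewrite (_ : _ I01 = lebesgue_measure (`[0, 1]%classic : set R)) //.
by rewrite lebesgue_measure_itv/= lte_fin ltr01 oppr0 adde0.
Qed.

Lemma modularE l u : 0 < l -> modular p (fun x => (l^-1)%:C *: u x) =
  (\int[mu]_(x in I01) phi (p x) (l^-1 * rnorm (u x)))%E.
Proof.
move=> l0; apply: eq_integral => x _; congr (phi _ _).
by rewrite rnormZ// invr_ge0 ltW.
Qed.

Lemma measurable_rnorm_itv u : sm u ->
  measurable_fun I01 ((fun x => rnorm (u x)) : lebesgueR R -> R).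
Proof. exact: (measurable_rnorm (@completed_lebesgue_measure_is_complete R)). Qed.

Lemma measurable_phi_rnorm l u : sm u ->
  measurable_fun I01 ((fun x => phi (p x) (l^-1 * rnorm (u x))) : lebesgueR R -> \bar R).
Proof.
move=> su.
have mu1 : measurable_fun I01 ((fun x => l^-1 * rnorm (u x)) : lebesgueR R -> R).
  apply: measurable_funM; first exact: measurable_cst.
  exact: measurable_rnorm_itv.
exact: (measurable_phi measurable_unit_itv hp.1 mu1 hp.2).
Qed.

Lemma scaled_rnorm_ge0 l (x : X) : 0 < l -> 0 <= l^-1 * rnorm x.
Proof. by move=> l0; rewrite mulr_ge0 ?rnorm_ge0 ?invr_ge0 ?ltW. Qed.

Lemma luxemburg_le l u : 0 < l ->
  (modular p (fun x => (l^-1)%:C *: u x) <= 1)%E ->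
  (luxemburg_norm p u <= l%:E)%E.
Proof. by move=> l0 h; apply: ereal_inf_lbound; exists l. Qed.

Lemma luxemburg_ge0 u : (0 <= luxemburg_norm p u)%E.
Proof. by apply: le_ereal_inf_tmp => _ [l [l0 _] <-]; rewrite lee_fin ltW. Qed.

(** The infimum need not be attained, but the modular is monotone in the scaling,
    so any strict upper bound of the norm is an admissible scaling. *)
Lemma luxemburg_lt l u : sm u -> (luxemburg_norm p u < l%:E)%E ->
  0 < l /\ (modular p (fun x => (l^-1)%:C *: u x) <= 1)%E.
Proof.
move=> su /ereal_inf_lt[_ [m [m0 hm] <-]]; rewrite lte_fin => ml.
have l0 := lt_trans m0 ml; split=> //; apply: le_trans hm.
rewrite !modularE//; apply: (ge0_le_integral _ measurable_unit_itv).
- by move=> x _; exact: phi_ge0.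
- exact: measurable_phi_rnorm.
- exact: measurable_phi_rnorm.
move=> x Ix; apply: phi_homo; first exact: hp.2.
  exact: scaled_rnorm_ge0.
by rewrite ler_wpM2r ?rnorm_ge0// lef_pV2 ?posrE// ltW.
Qed.

Lemma luxemburg_dist_sym u v : luxemburg_dist p u v = luxemburg_dist p v u.
Proof.
rewrite /luxemburg_dist /luxemburg_norm; congr ereal_inf; apply/seteqP.
by split=> _ [l [l0 h] <-]; exists l => //; split=> //; move: h;
  rewrite !modularE//; under eq_integral do rewrite rdistC.
Qed.

(** If the modulars of [(u - v) / l] and [(v - w) / m] are at most 1, then so is that
    of [(u - w) / (l + m)]: it is bounded by a convex combination of the two, with
    weights [l / (l + m)] and [m / (l + m)]. *)
Lemma luxemburg_dist_triangle u v w : sm u -> sm v -> sm w ->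
  (luxemburg_dist p u w <= luxemburg_dist p u v + luxemburg_dist p v w)%E.
Proof.
move=> su sv sw.
have suv := strongly_measurable_sub su sv.
have svw := strongly_measurable_sub sv sw.
have suw := strongly_measurable_sub su sw.
have := luxemburg_ge0 (fun x => v x - w x).
have := luxemburg_ge0 (fun x => u x - v x).
have := fun m => @luxemburg_lt m _ svw.
have := fun l => @luxemburg_lt l _ suv.
rewrite /luxemburg_dist.
move: (luxemburg_norm p (fun x => u x - v x)) => a.
move: (luxemburg_norm p (fun x => v x - w x)) => b lt_a lt_b a0 b0.
have [->|aoo] := eqVneq a +oo%E.
  by rewrite addye ?leey// gt_eqF// (lt_le_trans _ b0).
have [->|boo] := eqVneq b +oo%E.
  by rewrite addey ?leey// gt_eqF// (lt_le_trans _ a0).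
have aF : a \is a fin_num by rewrite ge0_fin_numE// ltey.
have bF : b \is a fin_num by rewrite ge0_fin_numE// ltey.
apply/lee_addgt0Pr => e e0.
set l := fine a + e / 2; set m := fine b + e / 2.
have e20 : 0 < e / 2 by rewrite divr_gt0.
have /lt_a[l0 hl] : (a < l%:E)%E by rewrite -(fineK aF) lte_fin ltrDl.
have /lt_b[m0 hm] : (b < m%:E)%E by rewrite -(fineK bF) lte_fin ltrDl.
have -> : (a + b + e%:E = (l + m)%:E)%E.
  by rewrite -(fineK aF) -(fineK bF) -!EFinD; congr (_%:E); rewrite /l /m; lra.
have lm0 : 0 < l + m by rewrite addr_gt0.
apply: luxemburg_le => //.
move: hl hm; rewrite !modularE// => hl hm.
pose A := l / (l + m); pose B := m / (l + m).
have A0 : 0 < A by rewrite divr_gt0.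
have B0 : 0 < B by rewrite divr_gt0.
have AB : A + B = 1 by rewrite /A /B -mulrDl divff// gt_eqF.
pose f x := phi (p x) (l^-1 * rnorm (u x - v x)).
pose g x := phi (p x) (m^-1 * rnorm (v x - w x)).
apply: (@le_trans _ _ (\int[mu]_(x in I01) (A%:E * f x + B%:E * g x))%E).
  apply: (ge0_le_integral _ measurable_unit_itv).
  - by move=> x _; exact: phi_ge0.
  - exact: measurable_phi_rnorm.
  - by apply: emeasurable_funD; apply: measurable_funeM; exact: measurable_phi_rnorm.
  move=> x Ix; have p1 := hp.2 _ Ix.
  apply: le_trans (phi_convex p1 (scaled_rnorm_ge0 _ l0) (scaled_rnorm_ge0 _ m0) A0 B0 AB).
  apply: phi_homo => //; first exact: scaled_rnorm_ge0.
  have -> : A * (l^-1 * rnorm (u x - v x)) + B * (m^-1 * rnorm (v x - w x)) =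
      (l + m)^-1 * (rnorm (u x - v x) + rnorm (v x - w x)).
    by rewrite /A /B; field; rewrite !gt_eqF.
  by rewrite ler_wpM2l ?invr_ge0 ?(ltW lm0)// ler_rdistD.
rewrite (ge0_integralD _ measurable_unit_itv); first last.
- by apply: measurable_funeM; exact: measurable_phi_rnorm.
- by move=> x _; rewrite mule_ge0 ?lee_fin ?(ltW B0) ?phi_ge0.
- by apply: measurable_funeM; exact: measurable_phi_rnorm.
- by move=> x _; rewrite mule_ge0 ?lee_fin ?(ltW A0) ?phi_ge0.
rewrite !(ge0_integralZl_EFin _ measurable_unit_itv) ?(ltW A0) ?(ltW B0) //; first last.
- exact: measurable_phi_rnorm.
- by move=> x _; exact: phi_ge0.
- exact: measurable_phi_rnorm.
- by move=> x _; exact: phi_ge0.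
have -> : 1%E = (A%:E * 1 + B%:E * 1)%E :> \bar R by rewrite !mule1 -EFinD AB.
by apply: leeD; apply: lee_wpmul2l; rewrite ?lee_fin ?(ltW A0) ?(ltW B0).
Qed.

Lemma integral_rnorm_le l u : sm u -> (luxemburg_norm p u < l%:E)%E ->
  (\int[mu]_(x in I01) (rnorm (u x))%:E <= (2 * l)%:E)%E.
Proof.
move=> su /(luxemburg_lt su)[l0]; rewrite modularE// => hl.
have mphi := measurable_phi_rnorm l su.
have m1 : measurable_fun I01
    ((fun x => 1 + phi (p x) (l^-1 * rnorm (u x)))%E : lebesgueR R -> \bar R).
  by apply: emeasurable_funD => //; exact: measurable_cst.
apply: (@le_trans _ _
   (\int[mu]_(x in I01) (l%:E * (1 + phi (p x) (l^-1 * rnorm (u x)))))%E).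
  apply: (ge0_le_integral _ measurable_unit_itv).
  - by move=> x _; rewrite lee_fin rnorm_ge0.
  - by apply/measurable_EFinP; exact: measurable_rnorm_itv.
  - exact: measurable_funeM m1.
  move=> x Ix.
  have := le_1Dphi (hp.2 _ Ix) (scaled_rnorm_ge0 (u x) l0).
  move=> /(lee_wpmul2l (ltW l0 : (0 <= l%:E)%E)); apply: le_trans.
  by rewrite -EFinM mulrA divff ?mul1r// gt_eqF.
rewrite (ge0_integralZl_EFin _ measurable_unit_itv _ m1) ?(ltW l0)//; last first.
  by move=> x _; rewrite adde_ge0 ?phi_ge0.
rewrite (ge0_integralD _ measurable_unit_itv _ _ _ mphi); first last.
- by move=> x _; exact: phi_ge0.
- exact: measurable_cst.
- by [].
rewrite (integral_cst _ measurable_unit_itv).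
rewrite measure_unit_itv mule1 mulrC EFinM.
apply: lee_wpmul2l; first by rewrite lee_fin ltW.
have -> : 2%:E = (1 + 1)%E :> \bar R by rewrite -EFinD.
by rewrite leeD.
Qed.

(** Fatou's lemma. Allowing the slightly larger scaling [e + r] for the limit, against
    [e + r / 2] for the sequence, replaces lower semicontinuity of [phi], which would
    distinguish finite and infinite exponents, by its monotonicity. *)
Lemma luxemburg_lower_semicontinuous (e : R) (u_ : nat -> R -> X) u :
  0 <= e -> (forall n, sm (u_ n)) -> sm u ->
  {ae mu, forall x, I01 x -> u_ n x @[n --> \oo] --> u x} ->
  (forall n, (luxemburg_norm p (u_ n) <= e%:E)%E) ->
  (luxemburg_norm p u <= e%:E)%E.
Proof.
move=> e0 su_ su uu hu; apply/lee_addgt0Pr => r r0.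
rewrite -EFinD; have er0 : 0 < e + r by rewrite ltr_wpDl.
have m0 : 0 < e + r / 2 by rewrite ltr_wpDl// divr_gt0.
apply: luxemburg_le => //; rewrite modularE//.
have hm n : (\int[mu]_(x in I01) phi (p x) ((e + r / 2)^-1 * rnorm (u_ n x)) <= 1)%E.
  rewrite -modularE//; apply: (luxemburg_lt (su_ n) _).2.
  by apply: (le_lt_trans (hu n)); rewrite lte_fin ltrDl divr_gt0.
set f := fun n x => phi (p x) ((e + r / 2)^-1 * rnorm (u_ n x)).
have mf n : measurable_fun I01 (f n : lebesgueR R -> \bar R).
  exact: measurable_phi_rnorm.
apply: (@le_trans _ _ (\int[mu]_(x in I01) limn_einf (f^~ x))%E); last first.
  apply: le_trans (fatou _ measurable_unit_itv mf _) _.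
    by move=> n x _; exact: phi_ge0.
  by apply: limn_einf_le => n; exact: hm.
apply: (ae_ge0_le_integral measurable_unit_itv).
- by move=> x _; exact: phi_ge0.
- exact: measurable_phi_rnorm.
- by move=> x _; apply: le_limn_einf; apply: nearW => n; exact: phi_ge0.
- exact: measurable_fun_limn_einf.
apply: filterS uu => x + Ix => /(_ Ix)/cvg_rdistP ux.
apply: le_limn_einf.
have [->|ux0] := eqVneq (rnorm (u x)) 0.
  by apply: nearW => n; rewrite mulr0 phi_at0 ?phi_ge0//; exact: hp.2.
have {}ux0 : 0 < rnorm (u x) by rewrite lt_def ux0 rnorm_ge0.
(* As [c < 1], eventually [c * rnorm (u x) <= rnorm (u_ n x)]. *)
pose c := (e + r / 2) / (e + r).
have c1 : 0 < 1 - c by rewrite subr_gt0 ltr_pdivrMr// mul1r; lra.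
have := ux _ (mulr_gt0 c1 ux0); apply: filterS => n h.
apply: phi_homo; [exact: hp.2|exact: scaled_rnorm_ge0|].
rewrite ler_pdivlMl// mulrA.
have -> : (e + r / 2) * (e + r)^-1 = c by [].
have := ler_rdistD (u_ n x) (u x) 0; rewrite !subr0 rdistC; nra.
Qed.

End luxemburg.

(** * Bochner's criterion *)

Section bochner_criterion.
Variables (R : realType) (Y : Type) (dist : Y -> Y -> \bar R) (F : R -> Y).
Hypothesis dist_sym : forall s t, dist (F s) (F t) = dist (F t) (F s).
Hypothesis dist_triangle : forall r s t,
  (dist (F r) (F t) <= dist (F r) (F s) + dist (F s) (F t))%E.
Hypothesis apF : bohr_almost_periodic dist F.

Let close (e : R) s t := (dist (F s) (F t) <= e%:E)%E.

Let closeC e s t : close e s t -> close e t s.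
Proof. by rewrite /close dist_sym. Qed.

Let close_trans e e' r s t : close e r s -> close e' s t -> close (e + e') r t.
Proof.
by move=> h h'; apply: le_trans (dist_triangle r s t) _; rewrite EFinD leeD.
Qed.

(** Uniform on [[0, l]] by compactness; any pair of close points is moved near
    [[0, l]] by a common almost period, at the cost of two more errors. *)
Lemma almost_periodic_uniformly_continuous (e : R) : 0 < e ->
  exists2 d : R, 0 < d & forall s t, `|s - t| < d -> (dist (F s) (F t) <= e%:E)%E.
Proof.
move=> e0; pose e4 := e / 4; have e40 : 0 < e4 by rewrite divr_gt0.
have [cF ap] := apF; have [l l0 hl] := ap e4 e40.
have cov (x : R) : `[(0 : R), l]%classic x -> \forall x' \near x & d \near 0^'+,
    forall s, `|s - x'| < d -> close (e4 + e4) s x'.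
  move=> _.
  have : \forall s \near x, close e4 s x.
    have nb : nbhs (0%E : \bar R) [set y | (y < e4%:E)%E].
      by apply: open_nbhs_nbhs; split; [exact: open_ereal_lt_ereal|rewrite /= lte_fin].
    have cx : (dist (F s) (F x) @[s --> x]) [set y | (y < e4%:E)%E] := cF x _ nb.
    by apply: (filterS _ (cx : nbhs x _)) => s /=; exact: ltW.
  move=> /nbhs_ballP[h /= h0 hx]; have h20 : 0 < h / 2 by rewrite divr_gt0.
  exists (ball x (h / 2), [set d | d < h / 2]) => /=.
    by split; [exact: nbhsx_ballx|exact: nbhs_right_lt].
  move=> [x' d] [/= xx' dh] s sx'; apply: (@close_trans _ _ _ x).
    apply: hx; rewrite /ball/= in xx' *; rewrite distrC.
    have := ler_distD x' s x; rewrite (distrC x') => h1.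
    apply: (le_lt_trans h1); lra.
  apply: closeC; apply: hx; rewrite /ball/= in xx' *; apply: (lt_trans xx'); lra.
have /compact_near_coveringP/(_ _ _ _ _ cov) := @segment_compact R 0 l.
move=> /(filterI (nbhs_right_gt 0)) /filter_ex[d /= [d0 hd]].
exists d => // s t std; have [tau /andP[tau1 tau2] htau] := hl (- t).
have ttau : `[(0 : R), l]%classic (t + tau) by rewrite /= in_itv/=; apply/andP; split; lra.
have : close (e4 + e4) (s + tau) (t + tau).
  by apply: (hd _ ttau); rewrite (_ : _ - _ = s - t)//; ring.
move=> /(close_trans (closeC (htau s))) /close_trans/(_ (htau t)).
by rewrite /close; congr (_ <= _%:E)%E; rewrite /e4; lra.
Qed.

(** The almost periods [tau n] depend on [e], hence so do the points [a n + tau n]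
    and their limit; the ultrafilter does not. *)
Lemma ultrafilter_close_translates (U : set_system nat) (a : nat -> R) (e : R) :
  UltraFilter U -> 0 < e -> exists2 A, U A &
    forall n m, A n -> A m -> forall t, (dist (F (a n + t)) (F (a m + t)) <= e%:E)%E.
Proof.
move=> UU e0; pose e4 := e / 4; have e40 : 0 < e4 by rewrite divr_gt0.
have [l l0 hl] := apF.2 e4 e40.
have [d d0 hd] := almost_periodic_uniformly_continuous e40.
have /choice[tau htau] : forall n, exists tau : R, - a n <= tau <= - a n + l /\
    forall t, close e4 (t + tau) t.
  by move=> n; have [tau h1 h2] := hl (- a n); exists tau.
pose b n := a n + tau n.
have bI : U (b @^-1` `[0, l]%classic).
  apply: filterE => n /=; have [/andP[h1 h2] _] := htau n.
  by rewrite in_itv/= /b; apply/andP; split; lra.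
have [c [_ cl]] := @segment_compact R 0 l (b @ U) _ bI.
(* An ultrafilter with a cluster point [c] contains every ball around [c]. *)
exists (b @^-1` ball c d).
  have [//|nb] := in_ultra_setVsetC (b @^-1` ball c d) UU.
  have [x [/= nx bx]] := cl (~` ball c d) (ball c d) nb (nbhsx_ballx _ _ d0).
  by [].
have closec n t : ball c d (b n) -> close (e4 + e4) (a n + t) (c + t).
  move=> bn; apply: (@close_trans _ _ _ (a n + t + tau n)).
    by apply: closeC; exact: (htau n).2.
  apply: hd; have -> : a n + t + tau n - (c + t) = b n - c by rewrite /b; ring.
  by rewrite distrC.
move=> n m bn bm t.
have := close_trans (closec n t bn) (closeC (closec m t bm)).
by rewrite /close; congr (_ <= _%:E)%E; rewrite /e4; lra.
Qed.

(** The sets given by [ultrafilter_close_translates] at the precisions [e k] have the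
    finite intersection property and meet every neighbourhood of infinity, so
    indices can be chosen one after the other without nested subsequences. *)
Lemma almost_periodic_bochner (e a : nat -> R) : (forall k, 0 < e k) ->
  exists n : nat -> nat, {homo n : i j / (i < j)%N} /\
    forall k j t, (k <= j)%N ->
      (dist (F (a (n k) + t)) (F (a (n j) + t)) <= (e k)%:E)%E.
Proof.
move=> e0; have [U [UU Uoo]] := ultraFilterLemma (@eventually_filter).
have /choice[A hA] : forall k, exists A, U A /\ forall n m, A n -> A m ->
    forall t, (dist (F (a n + t)) (F (a m + t)) <= (e k)%:E)%E.
  move=> k; have [A UA hA] := ultrafilter_close_translates a UU (e0 k).
  by exists A.
have UA k : U [set n | forall i, (i <= k)%N -> A i n].
  elim: k => [|k IHk].
    by apply: filterS (hA 0%N).1 => n An i; rewrite leqn0 => /eqP ->.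
  apply: filterS2 IHk (hA k.+1).1 => n h An i.
  by rewrite leq_eqVlt => /predU1P[->//|]; rewrite ltnS; exact: h.
have /choice[c hc] : forall km : nat * nat, exists n, (km.2 < n)%N /\
    forall i, (i <= km.1)%N -> A i n.
  move=> [k m]; have Um : U [set n | (m < n)%N] by apply: Uoo; exists m.+1.
  by have [n [h1 h2]] := filter_ex (filterI Um (UA k)); exists n.
pose n := fix n k := if k is k'.+1 then c (k, n k') else c (0%N, 0%N).
have nA k i : (i <= k)%N -> A i (n k).
  by case: k => [|k]; [exact: (hc (0%N, 0%N)).2|exact: (hc (k.+1, n k)).2].
exists n; split.
  by apply: homo_ltn => [|k]; [exact: ltn_trans|exact: (hc (k.+1, n k)).1].
move=> k j t kj; apply: (hA k).2; exact: nA.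
Qed.

End bochner_criterion.

(** * Almost everywhere limits of fast Cauchy sequences *)

Section summable_steps.
Variables (R : realType) (X : completeNormedModType R[i]).

Lemma summable_rdist_cvg (s : nat -> X) :
  (\sum_(0 <= k <oo) (rnorm (s k - s k.+1))%:E < +oo)%E ->
  exists l : X, s n @[n --> \oo] --> l.
Proof.
move=> sfin; apply: rdist_cauchy_cvg => e e0.
have d0 k : (0 <= (rnorm (s k - s k.+1))%:E)%E by rewrite lee_fin rnorm_ge0.
have tail := nneseries_tail_cvg sfin (fun k _ => d0 k).
have nb : nbhs (0%E : \bar R) [set y | (y < e%:E)%E].
  by apply: open_nbhs_nbhs; split; [exact: open_ereal_lt_ereal|rewrite /= lte_fin].
have [N _ /(_ N (leqnn N)) /= tailN] := tail _ nb.
exists N => n Nn; rewrite -lte_fin; apply: le_lt_trans tailN.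
rewrite -(subnKC Nn); move: (n - N)%N => m.
rewrite (nneseries_split N m); last by move=> k _; exact: d0.
apply: (@le_trans _ _ (\sum_(N <= k < N + m) (rnorm (s k - s k.+1))%:E)%E).
  rewrite sumEFin lee_fin; elim: m => [|m IHm].
    by rewrite addn0 big_geq// subrr rnorm0.
  rewrite addnS big_nat_recr ?leq_addr//=.
  apply: le_trans (ler_rdistD (s (N + m)%N) _ _) _; rewrite addrC lerD//.
  by rewrite rdistC.
by rewrite leeDl// nneseries_ge0// => k _ _; exact: d0.
Qed.

Variable p : R -> \bar R.
Hypothesis hp : variable_exponent p.
Local Notation mu := (@completed_lebesgue_measure R).
Local Notation I01 := (@unit_itv R).

(** The increments have summable $L^1$ norms, so by monotone convergence the series of
    their pointwise norms is integrable, hence finite almost everywhere. *)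
Lemma luxemburg_summable_ae_cvg (u_ : nat -> R -> X) (e : nat -> R) :
  (forall k, strongly_measurable mu I01 (u_ k : lebesgueR R -> X)) ->
  (forall k, 0 < e k) -> (\sum_(0 <= k <oo) (e k)%:E < +oo)%E ->
  (forall k, (luxemburg_dist p (u_ k) (u_ k.+1) <= (e k)%:E)%E) ->
  {ae mu, forall x, I01 x -> exists l : X, u_ k x @[k --> \oo] --> l}.
Proof.
move=> smu e0 sume hu.
have smd k := strongly_measurable_sub (smu k) (smu k.+1).
pose d k (x : lebesgueR R) := (rnorm (u_ k x - u_ k.+1 x))%:E.
have md k : measurable_fun I01 (d k).
  by apply/measurable_EFinP; exact: measurable_rnorm_itv.
have d0 k x : (0 <= d k x)%E by rewrite lee_fin rnorm_ge0.
have Id : (\int[mu]_(x in I01) (\sum_(0 <= k <oo) d k x) < +oo)%E.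
  rewrite (integral_nneseries _ (@measurable_unit_itv R) md); last by move=> *; exact: d0.
  apply: (@le_lt_trans _ _ (\sum_(0 <= k <oo) (4%:E * (e k)%:E))%E).
    apply: lee_nneseries => [k _ _|k _].
      by apply: integral_ge0 => x _; exact: d0.
    (* The bound on the norm is only weak, while an admissible scaling must exceed it. *)
    have lte : (luxemburg_dist p (u_ k) (u_ k.+1) < (2 * e k)%:E)%E.
      by apply: le_lt_trans (hu k) _; rewrite lte_fin; have := e0 k; lra.
    apply: le_trans (integral_rnorm_le hp (smd k) lte) _.
    by rewrite -EFinM lee_fin; lra.
  rewrite nneseriesZl; last by move=> k _; rewrite lee_fin ltW.
  by rewrite lte_mul_pinfty ?lee_fin.
have : mu.-integrable I01 (fun x => \sum_(0 <= k <oo) d k x)%E.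
  apply/integrableP; split.
    by apply: ge0_emeasurable_sum => // k x _ _; exact: d0.
  rewrite (eq_integral (fun x => \sum_(0 <= k <oo) d k x)%E)// => x _.
  by rewrite gee0_abs// nneseries_ge0// => k _ _; exact: d0.
move=> /(integrable_ae (@measurable_unit_itv R)); apply: filterS => x + Ix => /(_ Ix).
move=> dfin; apply: summable_rdist_cvg.
by rewrite -ge0_fin_numE// nneseries_ge0// => k _ _; exact: d0.
Qed.

End summable_steps.

Section almost_automorphy.
Variables (R : realType) (X : completeNormedModType R[i]) (p : R -> \bar R).
Hypothesis hp : variable_exponent p.
Local Notation mu := (@completed_lebesgue_measure R).
Local Notation I01 := (@unit_itv R).

(** The line is covered by the countably many translates of [[0, 1]] by integers. *)
Lemma ae_from_unit_itvs (P : R -> Prop) :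
  (forall t : R, {ae mu, forall x, I01 x -> P (t + x)}) -> {ae mu, forall x, P x}.
Proof.
move=> hP; pose c (n : nat) : R := if unpickle n is Some m then (m : int)%:~R else 0.
have hc n : {ae mu, forall x, I01 (x - c n) -> P x}.
  have [N [mN N0 PN]] := ae_translate (- c n) (hP (c n)); exists N; split=> // x /= nx.
  by apply: PN => /= h; apply: nx => /h; rewrite addrC subrK.
have := ae_foralln hc; apply: filterS => x /(_ (pickle (Num.floor x))).
rewrite /c pickleK; apply; rewrite /unit_itv/= in_itv/=.
by have := floor_itv x; rewrite intrD => /andP[h1 h2]; apply/andP; split; lra.
Qed.

Lemma in_Lp_of_luxemburg (u : R -> X) :
  strongly_measurable mu I01 (u : lebesgueR R -> X) ->
  (luxemburg_norm p u < +oo)%E -> in_Lp p u.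
Proof.
move=> su uoo; split=> //.
pose l := fine (luxemburg_norm p u) + 1.
have [|l0 hl] := @luxemburg_lt R X p hp l u su.
  have uF : luxemburg_norm p u \is a fin_num by rewrite ge0_fin_numE// luxemburg_ge0.
  by rewrite -(fineK uF) lte_fin /l ltrDl.
by exists l^-1; [rewrite invr_gt0|rewrite (le_lt_trans hl) ?ltry].
Qed.

Lemma strongly_measurable_0 d (T : measurableType d) (m : {measure set T -> \bar R})
  (D : set T) : measurable D -> strongly_measurable m D (fun _ => 0 : X).
Proof.
move=> mD; exists (fun _ _ => 0); split=> [n|]; last first.
  by apply: aeW => x _; exact: cvg_cst.
split=> [|c]; first by apply: sub_finite_set (finite_set1 0) => _ [x _ <-].
have [->|c0] := pselect (c = 0).
  by rewrite (_ : _ `&` _ = D)//; apply/seteqP; split=> [x []|x].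
by rewrite (_ : _ `&` _ = set0)//; apply/seteqP; split=> [x [_ /esym]|x].
Qed.

End almost_automorphy.

(** * Almost automorphy *)

Section limit_of_translates.
Variables (R : realType) (X : completeNormedModType R[i]) (p : R -> \bar R).
Hypothesis hp : variable_exponent p.
Local Notation mu := (@completed_lebesgue_measure R).
Local Notation I01 := (@unit_itv R).
Variables (f : R -> X) (b e : nat -> R).
Hypothesis bf : stepanov_bounded p f.
Hypothesis e_gt0 : forall k, 0 < e k.
Hypothesis e_summable : (\sum_(0 <= k <oo) (e k)%:E < +oo)%E.
Hypothesis translates_cauchy : forall k j t, (k <= j)%N ->
  (luxemburg_dist p (fun x => f (b k + x + t)) (fun x => f (b j + x + t))
    <= (e k)%:E)%E.

Let sm_tr (u : R -> X) t : strongly_measurable mu setT (u : lebesgueR R -> X) ->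
  strongly_measurable mu I01 ((fun x => u (x + t)) : lebesgueR R -> X).
Proof.
move=> su; apply: (strongly_measurableS (@measurable_unit_itv R)).
exact: strongly_measurable_translate.
Qed.

Let fb k x := f (b k + x).

Let sm_fb k : strongly_measurable mu setT (fb k : lebesgueR R -> X).
Proof.
have [sf _ _] := bf; rewrite (_ : fb k = fun x => f (x + b k)).
  exact: strongly_measurable_translate.
by apply/funext => x; rewrite /fb addrC.
Qed.

Let fbE k t : (fun x => f (b k + x + t)) = (fun x => fb k (x + t)).
Proof. by apply/funext => x; rewrite /fb addrA. Qed.

Let g x : X := xget 0 [set l | fb k x @[k --> \oo] --> l].

(** The increments are summable for every translate of the unit interval along one
    and the same sequence, so the limits on different intervals agree. *)
Let fb_g : {ae mu, forall x, fb k x @[k --> \oo] --> g x}.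
Proof.
have [N [mN N0 hN]] :
    {ae mu, forall x, exists l : X, fb k x @[k --> \oo] --> l}; last first.
  by exists N; split=> // x /= nx; apply: hN => /(xgetPex 0).
apply: ae_from_unit_itvs => t.
have := luxemburg_summable_ae_cvg hp (fun k => sm_tr t (sm_fb k)) e_gt0 e_summable.
have steps k : (luxemburg_dist p (fun x => fb k (x + t)) (fun x => fb k.+1 (x + t))
    <= (e k)%:E)%E.
  by rewrite -!fbE; exact: translates_cauchy.
move=> /(_ steps)[N [mN N0 hN]]; exists N; split=> // x /= nx.
by apply: hN => h; apply: nx => /h; rewrite addrC.
Qed.

Let sm_g : strongly_measurable mu setT (g : lebesgueR R -> X).
Proof.
apply: (strongly_measurable_ae_lim _ sm_fb fb_g).
exact: (sigma_finiteT mu).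
Qed.

Let fb_g_close k t :
  (luxemburg_dist p (fun x => fb k (x + t)) (fun x => g (x + t)) <= (e k)%:E)%E.
Proof.
apply: (luxemburg_lower_semicontinuous hp
    (u_ := fun j x => fb k (x + t) - fb (k + j)%N (x + t))).
- exact: ltW.
- by move=> j; apply: strongly_measurable_sub; exact: sm_tr.
- by apply: strongly_measurable_sub; exact: sm_tr.
- have [N [mN N0 hN]] := ae_translate t fb_g; exists N; split=> // x /= nx.
  apply: hN => /= h; apply: nx => _; apply: cvgB; first exact: cvg_cst.
  by under eq_fun do rewrite addnC; move: h; rewrite -(cvg_shiftn k).
- by move=> j; have := translates_cauchy t (leq_addr j k); rewrite !fbE.
Qed.

Let g_norm_le t : (luxemburg_norm p (fun x => g (x + t)) <=
  (e 0%N)%:E + stepanov_norm p f)%E.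
Proof.
have norm0 (u : R -> X) : luxemburg_norm p u = luxemburg_dist p u (fun _ => 0).
  by congr luxemburg_norm; apply/funext => x; rewrite subr0.
have sm0 := strongly_measurable_0 X mu (@measurable_unit_itv R).
rewrite norm0; apply: le_trans (luxemburg_dist_triangle hp (sm_tr t sm_g)
  (sm_tr t (sm_fb 0)) sm0) _.
apply: leeD; first by rewrite luxemburg_dist_sym.
rewrite -norm0; apply: ereal_sup_ubound; exists (b 0%N + t).
  by [].
by congr luxemburg_norm; apply/funext => x; rewrite /fb; congr f; ring.
Qed.

(** Completeness of the Stepanov space along a fast Cauchy sequence of translates of
    [f] by [b k]. *)
Lemma stepanov_limit_of_translates : exists g : R -> X, stepanov_bounded p g /\
  forall k t, (luxemburg_dist p (fun x => f (b k + x + t)%R)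
    (fun x => g (x + t)%R) <= (e k)%:E)%E.
Proof.
have [_ _ foo] := bf.
have goo : ((e 0%N)%:E + stepanov_norm p f < +oo)%E by rewrite lte_add_pinfty ?ltry.
exists g; split=> [|k t]; last by rewrite fbE; exact: fb_g_close.
split=> [|t|]; first exact: sm_g.
- apply: in_Lp_of_luxemburg => //; first exact: sm_tr.
  exact: le_lt_trans (g_norm_le t) goo.
- apply: le_lt_trans goo; apply: ub_ereal_sup => _ [t _ <-]; exact: g_norm_le.
Qed.

End limit_of_translates.

Theorem proposition3p5 (R : realType) (X : completeNormedModType R[i])
    (p : R -> \bar R) (hp : variable_exponent p)
    (f : R -> X) (hf : stepanov_almost_periodic p f) :
  stepanov_almost_automorphic p f.
Proof.
have [bf apf] := hf; split=> // a.
have [_ Lpf _] := bf.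
have sF t : strongly_measurable (@completed_lebesgue_measure R) (@unit_itv R)
    (bochner_transform f t : lebesgueR R -> X).
  have [sft _] := Lpf t; rewrite (_ : bochner_transform f t = fun x => f (x + t))//.
  by apply/funext => x; rewrite /bochner_transform addrC.
pose e (k : nat) : R := 1 / (2 ^ (k + 1))%:R.
have e0 k : 0 < e k by rewrite divr_gt0// ltr0n expn_gt0.
have esum : (\sum_(0 <= k <oo) (e k)%:E < +oo)%E.
  by have /cvg_lim -> // := @cvg_geometric_eseries_half R 1 0; rewrite ltry.
have e_cvg : (e k)%:E @[k --> \oo] --> 0%E.
  apply: cvg_EFin; first exact: nearW.
  rewrite (_ : _ \o _ = geometric 2^-1 2^-1).
    by apply: cvg_geometric; rewrite ger0_norm ?invr_ge0// invf_lt1 ?ltr1n.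
  apply/funext => k /=; rewrite /e div1r natrX exprD expr1 invfM mulrC.
  by rewrite exprVn.
have [n [n_incr hn]] := almost_periodic_bochner
  (fun s t => luxemburg_dist_sym p (bochner_transform f s) (bochner_transform f t))
  (fun r s t => luxemburg_dist_triangle hp (sF r) (sF s) (sF t)) apf a e0.
have [g [bg hg]] : exists g : R -> X, stepanov_bounded p g /\
    forall k t, (luxemburg_dist p (fun x => f (a (n k) + x + t)%R)
      (fun x => g (x + t)%R) <= (e k)%:E)%E.
  apply: (stepanov_limit_of_translates hp bf e0 esum) => k j t kj.
  have bochnerE c : (fun x => f (c + x + t)) = bochner_transform f (c + t).
    by apply/funext => x; rewrite /bochner_transform addrAC.
  by rewrite !bochnerE; exact: hn.
have to0 (u_ v_ : nat -> R -> X) :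
    (forall k, (luxemburg_dist p (u_ k) (v_ k) <= (e k)%:E)%E) ->
    luxemburg_dist p (u_ k) (v_ k) @[k --> \oo] --> 0%E.
  move=> h; apply: (@squeeze_cvge _ _ _ _ (fun=> 0%E) _ (fun k => (e k)%:E)) => //.
    by apply: nearW => k; rewrite h luxemburg_ge0.
  exact: cvg_cst.
exists n, g; split=> // t; split; apply: to0 => k; first exact: hg.
(* The second limit is the first estimate at the point [t - a (n k)]. *)
have fE : (fun x => f (x + t)) = fun x => f (a (n k) + x + (t - a (n k))).
  by apply/funext => x; congr f; ring.
have gE : (fun x => g (x - a (n k) + t)) = fun x => g (x + (t - a (n k))).
  by apply/funext => x; congr g; ring.
by rewrite luxemburg_dist_sym fE gE; exact: hg.
Qed.
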